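(* Let $(TM,\lambda)$ be an EAP-space. The $W$-tensors corresponding to the natural metric $d$-connection $\mathring D$ are given by (with $|$, $||$ the covariant derivatives of the canonical $d$-connection): (a) $\mathring W^\alpha_{\beta\nu\mu}=(\gamma^\alpha_{\beta\mu|\nu}-\gamma^\alpha_{\beta\nu|\mu})+(\gamma^\epsilon_{\beta\nu}\gamma^\alpha_{\epsilon\mu}-\gamma^\epsilon_{\beta\mu}\gamma^\alpha_{\epsilon\nu})-\gamma^\alpha_{\beta\epsilon}\Lambda^\epsilon_{\nu\mu}$, (b) $\mathring W^a_{b\nu\mu}=(\gamma^a_{b\mu|\nu}-\gamma^a_{b\nu|\mu})+(\gamma^d_{b\nu}\gamma^a_{d\mu}-\gamma^d_{b\mu}\gamma^a_{d\nu})-\gamma^a_{b\epsilon}\Lambda^\epsilon_{\nu\mu}$, (c) $\mathring W^\alpha_{\beta\nu c}=(\gamma^\alpha_{\beta c|\nu}-\gamma^\alpha_{\beta\nu||c})+(\gamma^\epsilon_{\beta\nu}\gamma^\alpha_{\epsilon c}-\gamma^\epsilon_{\beta c}\gamma^\alpha_{\epsilon\nu})+(\gamma^d_{c\nu}\gamma^\alpha_{\beta d}-\gamma^\epsilon_{\nu c}\gamma^\alpha_{\beta\epsilon})$, (d) $\mathring W^a_{b\nu c}=(\gamma^a_{bc|\nu}-\gamma^a_{b\nu||c})+(\gamma^d_{b\nu}\gamma^a_{dc}-\gamma^d_{bc}\gamma^a_{d\nu})+(\gamma^d_{c\nu}\gamma^a_{bd}-\gamma^\epsilon_{\nu c}\gamma^a_{b\epsilon})$,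 (e) $\mathring W^\alpha_{\beta bc}=\mathring S^\alpha_{\beta cb}$, (f) $\mathring W^a_{bcd}=\mathring S^a_{bdc}$.
   Context: Let $M$ be a smooth paracompact $n$-manifold, $TM$ its tangent bundle with induced local coordinates $(x^\mu,y^a)$, and $N=(N^a_\mu(x,y))$ a given nonlinear connection on $TM$. Greek indices denote horizontal and Latin indices vertical components; both run over $1,\dots,n$; repeated indices (including the mesh index $i$) are summed. Put $\dot\partial_a=\partial/\partial y^a$, $\delta_\mu=\partial/\partial x^\mu-N^a_\mu\dot\partial_a$ (adapted frame $(\delta_\mu,\dot\partial_a)$). A $d$-connection is a linear connection $D$ on $TM$ preserving by parallelism the horizontal and the vertical distribution; its coefficients $(\Gamma^\alpha_{\mu\nu},\Gamma^a_{b\nu},C^\alpha_{\mu c},C^a_{bc})$ are defined by $D_{\delta_\nu}\delta_\mu=\Gamma^\alpha_{\mu\nu}\delta_\alpha$, $D_{\delta_\nu}\dot\partial_b=\Gamma^a_{b\nu}\dot\partial_a$, $D_{\dot\partial_c}\delta_\mu=C^\alpha_{\mu c}\delta_\alpha$, $D_{\dot\partial_c}\dot\partial_b=C^a_{bc}\dot\partial_a$. Its $h$- and $v$-covariant derivatives are $T^{\alpha a}{}_{\beta b|\mu}=\delta_\mu T^{\alpha a}_{\beta b}+T^{\epsilon a}_{\beta b}\Gamma^\alpha_{\epsilon\mu}+T^{\alpha d}_{\beta b}\Gamma^a_{d\mu}-T^{\alpha a}_{\epsilon b}\Gamma^\epsilon_{\beta\mu}-T^{\alpha a}_{\beta d}\Gamma^d_{b\mu}$,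 $T^{\alpha a}{}_{\beta b||c}=\dot\partial_cT^{\alpha a}_{\beta b}+T^{\epsilon a}_{\beta b}C^\alpha_{\epsilon c}+T^{\alpha d}_{\beta b}C^a_{dc}-T^{\alpha a}_{\epsilon b}C^\epsilon_{\beta c}-T^{\alpha a}_{\beta d}C^d_{bc}$, similarly for other types. Its curvature is $\mathbf R(X,Y)Z=D_XD_YZ-D_YD_XZ-D_{[X,Y]}Z$, with vertical components $\mathbf R(\dot\partial_b,\dot\partial_c)\delta_\beta=S^\alpha_{\beta bc}\delta_\alpha$, $\mathbf R(\dot\partial_c,\dot\partial_d)\dot\partial_b=S^a_{bcd}\dot\partial_a$ ($\mathring S$ for $\mathring D$). EAP-space $(TM,\lambda)$: $TM$ with $N$ and $n$ vector fields $\lambda_i=\lambda_i^\alpha\delta_\alpha+\lambda_i^a\dot\partial_a$ ($i=1,\dots,n$) defined globally on $TM$ with linearly independent horizontal parts and linearly independent vertical parts. $(\lambda_{i\alpha})$, $(\lambda_{ia})$ are the inverse matrices of $(\lambda_i^\alpha)$, $(\lambda_i^a)$. Metric: $g_{\alpha\beta}=\lambda_{i\alpha}\lambda_{i\beta}$, $g_{ab}=\lambda_{ia}\lambda_{ib}$, with inverses $g^{\alpha\beta}$, $g^{ab}$. Natural metric $d$-connection $\mathring D$: $\mathring\Gamma^\alpha_{\mu\nu}=\frac12g^{\alpha\epsilon}(\delta_\mu g_{\epsilon\nu}+\delta_\nu g_{\epsilon\mu}-\delta_\epsilon g_{\mu\nu})$, $\mathring\Gamma^a_{b\nu}=\dot\partial_bN^a_\nu+\frac12g^{ac}(\delta_\nu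 g_{bc}-g_{dc}\dot\partial_bN^d_\nu-g_{bd}\dot\partial_cN^d_\nu)$, $\mathring C^\alpha_{\mu c}=\frac12g^{\alpha\epsilon}\dot\partial_cg_{\mu\epsilon}$, $\mathring C^a_{bc}=\frac12g^{ad}(\dot\partial_bg_{dc}+\dot\partial_cg_{db}-\dot\partial_dg_{bc})$. Canonical $d$-connection: $\Gamma^\alpha_{\mu\nu}=\lambda_i^\alpha\delta_\nu\lambda_{i\mu}$, $\Gamma^a_{b\nu}=\lambda_i^a\delta_\nu\lambda_{ib}$, $C^\alpha_{\mu c}=\lambda_i^\alpha\dot\partial_c\lambda_{i\mu}$, $C^a_{bc}=\lambda_i^a\dot\partial_c\lambda_{ib}$; $\Lambda^\alpha_{\mu\nu}=\Gamma^\alpha_{\mu\nu}-\Gamma^\alpha_{\nu\mu}$. Contortion: $\gamma^\alpha_{\mu\nu}=\Gamma^\alpha_{\mu\nu}-\mathring\Gamma^\alpha_{\mu\nu}$, $\gamma^a_{b\mu}=\Gamma^a_{b\mu}-\mathring\Gamma^a_{b\mu}$, $\gamma^\alpha_{\mu c}=C^\alpha_{\mu c}-\mathring C^\alpha_{\mu c}$, $\gamma^a_{bc}=C^a_{bc}-\mathring C^a_{bc}$. $W$-tensors of a $d$-connection (with its own covariant derivatives $|$, $||$) are defined by requiring, for every $\lambda=\lambda_i$: $\lambda^\alpha{}_{|\nu|\mu}-\lambda^\alpha{}_{|\mu|\nu}=\lambda^\epsilon W^\alpha_{\epsilon\nu\mu}$; $\lambda^a{}_{|\nu|\mu}-\lambda^a{}_{|\mu|\nu}=\lambda^dW^a_{d\nu\mu}$;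 $\lambda^\alpha{}_{|\nu||c}-\lambda^\alpha{}_{||c|\nu}=\lambda^\epsilon W^\alpha_{\epsilon\nu c}$; $\lambda^a{}_{|\nu||c}-\lambda^a{}_{||c|\nu}=\lambda^dW^a_{d\nu c}$; $\lambda^\alpha{}_{||b||c}-\lambda^\alpha{}_{||c||b}=\lambda^\epsilon W^\alpha_{\epsilon bc}$; $\lambda^a{}_{||c||d}-\lambda^a{}_{||d||c}=\lambda^eW^a_{ecd}$. $\mathring W$ denotes those of $\mathring D$. *)

(* Defs.v *)
From HB Require Import structures.
From mathcomp Require Import all_boot all_order all_algebra.
From mathcomp Require Import all_classical all_reals all_analysis.

Set Implicit Arguments.
Unset Strict Implicit.
Unset Printing Implicit Defensive.

Import Order.TTheory GRing.Theory Num.Theory numFieldNormedType.Exports.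

Local Open Scope classical_set_scope.
Local Open Scope ring_scope.

(** * Smooth manifolds *)

(* In finite dimension these are the usual C^k functions on an open set: all
   iterated directional derivatives up to order k exist and are continuous. *)
Fixpoint Ck_on (R : realType) (E : normedModType R) (k : nat) (U : set E)
    (f : E -> R) : Prop :=
  match k with
  | 0 => {in U, continuous f}
  | k'.+1 => {in U, continuous f} /\
      forall v : E, (forall x, U x -> derivable f x v) /\
                    Ck_on k' U (fun x => 'D_v f x)
  end.

Definition smooth_on (R : realType) (E : normedModType R) (U : set E)
    (f : E -> R) : Prop := forall k, Ck_on k U f.

Definition paracompact (T : topologicalType) : Prop :=
  forall C : set (set T),
    (forall A, C A -> open A) -> \bigcup_(A in C) A = setT ->
    exists V : set (set T),
      [/\ forall B, V B -> open B /\ exists2 A, C A & B `<=` A,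
          \bigcup_(B in V) B = setT &
          forall x : T, exists2 O, nbhs x O &
            finite_set [set B | V B /\ (B `&` O) !=set0]].

(* A manifold with an arbitrary smooth atlas (possibly the maximal one).
   [ch_inv k] is only meaningful on the image of the k-th chart. *)
Record smooth_manifold (R : realType) (n : nat) := SmoothManifold {
  carrier :> topologicalType;
  carrier_hausdorff : hausdorff_space carrier;
  carrier_paracompact : paracompact carrier;
  chart : Type;
  ch_dom : chart -> set carrier;
  ch_map : chart -> carrier -> 'rV[R]_n;
  ch_inv : chart -> 'rV[R]_n -> carrier;
  ch_cover : forall m, exists k, ch_dom k m;
  ch_dom_open : forall k, open (ch_dom k);
  ch_img_open : forall k, open (ch_map k @` ch_dom k);
  ch_mapK : forall k m, ch_dom k m -> ch_inv k (ch_map k m) = m;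
  ch_map_cont : forall k, {within ch_dom k, continuous (ch_map k)};
  ch_inv_cont : forall k, {within ch_map k @` ch_dom k, continuous (ch_inv k)};
  ch_trans_smooth : forall k l (a : 'I_n),
    smooth_on (ch_map k @` (ch_dom k `&` ch_dom l))
      (fun x => ch_map l (ch_inv k x) ord0 a) }.

(** * Induced coordinates on the tangent bundle *)

(* The coordinates (x, y). *)
Definition tpt (R : realType) (n : nat) : Type := ('rV[R]_n * 'rV[R]_n)%type.

(* The two kinds of indices: horizontal (Greek) and vertical (Latin). *)
Inductive hv : Type := Hor | Ver.

Section InducedCoordinates.
Context (R : realType) (n : nat) (M : smooth_manifold R n).
Implicit Types (k l : chart M).

(* The image of the k-th induced chart of TM, and of its overlap with the
   l-th one. *)
Definition tdom k : set (tpt R n) :=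
  [set p | (ch_map k @` ch_dom k) p.1].
Definition toverlap k l : set (tpt R n) :=
  [set p | (ch_map k @` (ch_dom k `&` ch_dom l)) p.1].

Definition trans k l (a : 'I_n) (x : 'rV[R]_n) : R :=
  ch_map l (ch_inv k x) ord0 a.
Definition jac k l (a b : 'I_n) (x : 'rV[R]_n) : R :=
  'D_(delta_mx 0 b) (trans k l a) x.
Definition hess k l (a b c : 'I_n) (x : 'rV[R]_n) : R :=
  'D_(delta_mx 0 c) (jac k l a b) x.

(* y'^a = (dx'^a / dx^b) y^b *)
Definition ttrans k l (p : tpt R n) : tpt R n :=
  (\row_a trans k l a p.1, \row_a \sum_b jac k l a b p.1 * p.2 ord0 b).

(* Objects on TM are given by their components in every induced chart,
   subject to the transformation law.  The law for N says that the local
   horizontal fields d/dx^mu - N^a_mu d/dy^a span one and the same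
   distribution, and transform as delta_mu = (dx'^nu / dx^mu) delta'_nu. *)
Record nonlinear_connection := NonlinearConnection {
  nlc :> chart M -> 'I_n -> 'I_n -> tpt R n -> R;
  nlc_smooth : forall k a mu, smooth_on (tdom k) (nlc k a mu);
  nlc_trans : forall k l a mu p, toverlap k l p ->
    \sum_nu nlc l a nu (ttrans k l p) * jac k l nu mu p.1 =
    \sum_b jac k l a b p.1 * nlc k b mu p
    - \sum_b hess k l a b mu p.1 * p.2 ord0 b }.

(* [mesh N k i Hor a] and [mesh N k i Ver a] are the components of lambda_i in
   the frame adapted to N over the k-th chart; both transform as vectors. *)
Record eap_space (N : nonlinear_connection) := EAPSpace {
  mesh :> chart M -> 'I_n -> hv -> 'I_n -> tpt R n -> R;
  mesh_smooth : forall k i t a, smooth_on (tdom k) (mesh k i t a);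
  mesh_trans : forall k l i t a p, toverlap k l p ->
    mesh l i t a (ttrans k l p) = \sum_b jac k l a b p.1 * mesh k i t b p;
  mesh_indep : forall k t p, tdom k p ->
    row_free (\matrix_(i < n, a < n) mesh k i t a p) }.

End InducedCoordinates.

(** * d-connections over an induced chart *)

Section LocalGeometry.
Context (R : realType) (n : nat).
Local Notation pt := (tpt R n).
Local Notation fn := (pt -> R).

Definition ddx (mu : 'I_n) (f : fn) : fn :=
  fun p => 'D_((delta_mx 0 mu, 0) : pt) f p.
Definition ddy (a : 'I_n) (f : fn) : fn :=
  fun p => 'D_((0, delta_mx 0 a) : pt) f p.

(* Components in the adapted frame: [X Hor] and [X Ver]. *)
Definition vfield : Type := hv -> 'I_n -> fn.

(* [G t s a b c] is the coefficient with upper index a and lower index b of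
   kind t, and direction index c of kind s:
     G Hor Hor = Gamma^alpha_{mu nu},  G Ver Hor = Gamma^a_{b nu},
     G Hor Ver = C^alpha_{mu c},       G Ver Ver = C^a_{bc}.  *)
Definition dconn : Type := hv -> hv -> 'I_n -> 'I_n -> 'I_n -> fn.

Section NonlinearConnection.
Context (N : 'I_n -> 'I_n -> fn).

(* delta_c f if t = Hor, the c-th vertical derivative of f if t = Ver *)
Definition frame (t : hv) (c : 'I_n) (f : fn) : fn :=
  match t with
  | Hor => fun p => ddx c f p - \sum_a N a c p * ddy a f p
  | Ver => ddy c f
  end.

Section CovariantDerivative.
Context (G : dconn).

(* The h- (s = Hor) and v- (s = Ver) covariant derivatives of tensors of type
   (1,0), (1,1), (1,2); t, t1, t2 are the kinds of the tensor's own indices. *)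
Definition cov10 (t s : hv) (T : 'I_n -> fn) (a c : 'I_n) : fn := fun p =>
  frame s c (T a) p + \sum_e T e p * G t s a e c p.

Definition cov11 (t t1 s : hv) (T : 'I_n -> 'I_n -> fn)
    (a b c : 'I_n) : fn := fun p =>
  frame s c (T a b) p
  + \sum_e T e b p * G t s a e c p
  - \sum_e T a e p * G t1 s e b c p.

Definition cov12 (t t1 t2 s : hv) (T : 'I_n -> 'I_n -> 'I_n -> fn)
    (a b d c : 'I_n) : fn := fun p =>
  frame s c (T a b d) p
  + \sum_e T e b d p * G t s a e c p
  - \sum_e T a e d p * G t1 s e b c p
  - \sum_e T a b e p * G t2 s e d c p.

(* X f *)
Definition vact (X : vfield) (f : fn) : fn := fun p =>
  \sum_c X Hor c p * frame Hor c f p + \sum_c X Ver c p * frame Ver c f p.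

(* Components in the natural frame (d/dx^mu, d/dy^a), and back. *)
Definition to_natural (X : vfield) : vfield := fun t a p =>
  match t with
  | Hor => X Hor a p
  | Ver => X Ver a p - \sum_mu N a mu p * X Hor mu p
  end.
Definition of_natural (X : vfield) : vfield := fun t a p =>
  match t with
  | Hor => X Hor a p
  | Ver => X Ver a p + \sum_mu N a mu p * X Hor mu p
  end.

Definition lie_bracket (X Y : vfield) : vfield :=
  of_natural (fun t a p =>
    vact X (to_natural Y t a) p - vact Y (to_natural X t a) p).

(* D_X Y *)
Definition nabla (X Y : vfield) : vfield := fun t a p =>
  vact X (Y t a) p
  + \sum_e Y t e p * (\sum_c X Hor c p * G t Hor a e c p
                      + \sum_c X Ver c p * G t Ver a e c p).

Definition curvature (X Y Z : vfield) : vfield := fun t a p =>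
  nabla X (nabla Y Z) t a p - nabla Y (nabla X Z) t a p
  - nabla (lie_bracket X Y) Z t a p.

Definition frame_field (t : hv) (b : 'I_n) : vfield := fun s a _ =>
  match t, s with
  | Hor, Hor | Ver, Ver => (a == b)%:R
  | _, _ => 0
  end.

(* S^alpha_{beta b c} (t = Hor) and S^a_{b c d} (t = Ver) *)
Definition Scurv (t : hv) (a b c d : 'I_n) : fn :=
  curvature (frame_field Ver c) (frame_field Ver d) (frame_field t b) t a.

End CovariantDerivative.

Section Mesh.
Context (lam : 'I_n -> hv -> 'I_n -> fn).

Definition mesh_mx (t : hv) (p : pt) : 'M[R]_n :=
  \matrix_(i < n, a < n) lam i t a p.

(* lambda_{i a} *)
Definition comesh (i : 'I_n) (t : hv) (a : 'I_n) : fn :=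
  fun p => invmx (mesh_mx t p) a i.

Definition metric (t : hv) (a b : 'I_n) : fn :=
  fun p => \sum_i comesh i t a p * comesh i t b p.
Definition cometric (t : hv) (a b : 'I_n) : fn :=
  fun p => invmx (\matrix_(c < n, d < n) metric t c d p) a b.

Definition natural_dconn : dconn := fun t s a b c p =>
  match t, s with
  | Hor, Hor => 2^-1 * \sum_e cometric Hor a e p *
      (frame Hor b (metric Hor e c) p + frame Hor c (metric Hor e b) p
       - frame Hor e (metric Hor b c) p)
  | Ver, Hor => ddy b (N a c) p + 2^-1 * \sum_e cometric Ver a e p *
      (frame Hor c (metric Ver b e) p
       - \sum_d metric Ver d e p * ddy b (N d c) p
       - \sum_d metric Ver b d p * ddy e (N d c) p)
  | Hor, Ver => 2^-1 * \sum_e cometric Hor a e p * ddy c (metric Hor b e) p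
  | Ver, Ver => 2^-1 * \sum_e cometric Ver a e p *
      (ddy b (metric Ver e c) p + ddy c (metric Ver e b) p
       - ddy e (metric Ver b c) p)
  end.

Definition canonical_dconn : dconn := fun t s a b c p =>
  \sum_i lam i t a p * frame s c (comesh i t b) p.

Definition htorsion (a b c : 'I_n) : fn := fun p =>
  canonical_dconn Hor Hor a b c p - canonical_dconn Hor Hor a c b p.

Definition contortion (t s : hv) (a b c : 'I_n) : fn := fun p =>
  canonical_dconn t s a b c p - natural_dconn t s a b c p.

(* The argument of kind hv is the kind of the first two indices (upper, lower);
   hh, hv, vv are the kinds of the last two. *)
Record wtensors : Type := WTensors {
  W_hh : hv -> 'I_n -> 'I_n -> 'I_n -> 'I_n -> fn;
  W_hv : hv -> 'I_n -> 'I_n -> 'I_n -> 'I_n -> fn;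
  W_vv : hv -> 'I_n -> 'I_n -> 'I_n -> 'I_n -> fn }.

(* W are the W-tensors, over the chart image U, of the d-connection with
   coefficients G. *)
Definition is_wtensors (U : set pt) (G : dconn) (W : wtensors) : Prop :=
  forall (p : pt) (i : 'I_n) (t : hv) (a b c : 'I_n), U p ->
  [/\ cov11 G t Hor Hor (cov10 G t Hor (lam i t)) a b c p
      - cov11 G t Hor Hor (cov10 G t Hor (lam i t)) a c b p
      = \sum_e lam i t e p * W_hh W t a e b c p,
      cov11 G t Hor Ver (cov10 G t Hor (lam i t)) a b c p
      - cov11 G t Ver Hor (cov10 G t Ver (lam i t)) a c b p
      = \sum_e lam i t e p * W_hv W t a e b c p &
      cov11 G t Ver Ver (cov10 G t Ver (lam i t)) a b c p
      - cov11 G t Ver Ver (cov10 G t Ver (lam i t)) a c b p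
      = \sum_e lam i t e p * W_vv W t a e b c p].

End Mesh.
End NonlinearConnection.
End LocalGeometry.

(* Main.v *)
(** The canonical connection D is flat on the mesh: D lambda = 0.  Hence for
    D0 = D - gamma one has D0_c lambda^a = - lambda^e gamma^a_{ec}, and a second
    derivative gives
      D0_d D0_c lambda^a = lambda^b (- gamma^a_{bc|d} + gamma^e_{bc} gamma^a_{ed}
                                     - gamma^a_{be} gamma^e_{cd}),
    with | taken with respect to D.  Antisymmetrizing in (c, d) and using the
    linear independence of the mesh yields (a)-(d); in (a) and (b) the symmetry of
    the horizontal coefficients of D0 turns the last terms into Lambda.  Parts (e)
    and (f) are the Ricci identity: the bracket of two vertical frame fields
    vanishes, D0 has no vertical torsion, and the second vertical derivatives of
    lambda commute. *)

Require Import Defs.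
From mathcomp Require Import all_boot all_order all_algebra.
From mathcomp Require Import all_classical all_reals all_analysis.
From mathcomp Require Import ring.

Set Implicit Arguments.
Unset Strict Implicit.
Unset Printing Implicit Defensive.

Import Order.TTheory GRing.Theory Num.Theory numFieldNormedType.Exports.

Local Open Scope ring_scope.

(** * Closure of smooth functions on an open set under algebra, derivatives and matrix inversion *)

Section SmoothCalculus.
Context (R : realType) (E : normedModType R) (U : set E).
Context (openU : open U).
Implicit Types (f g : E -> R) (v w x : E).

Lemma eq_on_near f g x : (forall y, U y -> f y = g y) -> U x ->
  \near x, f x = g x.
Proof.
by move=> fg Ux; near=> y; apply: fg; near: y; exact: open_nbhs_nbhs.
Unshelve. all: by end_near. Qed.

Lemma eq_on_derive f g v x : (forall y, U y -> f y = g y) -> U x ->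
  'D_v f x = 'D_v g x.
Proof. by move=> fg Ux; apply: near_eq_derive; apply: eq_on_near. Qed.

(** Since [U] is open, continuity and directional derivatives at a point of [U] are local. The
    closure lemmas below rely on this: the sum, product and inverse rules identify derivatives only
    at points of [U]. *)
Lemma eq_Ck_on k f g : (forall y, U y -> f y = g y) -> Ck_on k U f -> Ck_on k U g.
Proof.
have cont f1 g1 : (forall y, U y -> f1 y = g1 y) -> {in U, continuous f1} ->
    {in U, continuous g1}.
  move=> fg fC x /[dup] xU /set_mem Ux; rewrite /continuous_at -(fg _ Ux).
  by apply: cvg_trans (fC x xU); apply: near_eq_cvg; exact: eq_on_near.
elim: k f g => [|k IH] f g fg; first exact: cont.
move=> [fC fD]; split; first exact: cont fC.
move=> v; have [fdv fk] := fD v; split.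
  move=> x Ux; apply: near_eq_derivable (fdv x Ux).
  exact: eq_on_near.
apply: IH fk => y Uy; exact: eq_on_derive.
Qed.

(** In the inductions on the order, this supplies the undifferentiated factors that occur in the
    derivative of a product or an inverse. *)
Lemma Ck_onW k f : Ck_on k.+1 U f -> Ck_on k U f.
Proof.
elim: k f => [f []//|k IH f [fC fD]]; split => // v.
by have [fd fk] := fD v; split => //; exact: IH.
Qed.

Lemma Ck_on_cst k (c : R) : Ck_on k U (fun _ => c).
Proof.
elim: k c => [c|k IH c]; first by move=> x _; exact: cvg_cst.
split; first by move=> x _; exact: cvg_cst.
move=> v; split=> [x _|]; first exact: derivable_cst.
by apply: eq_Ck_on (IH 0) => y _; rewrite (derive_cst c).
Qed.

Lemma Ck_onD k f g : Ck_on k U f -> Ck_on k U g -> Ck_on k U (fun x => f x + g x).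
Proof.
elim: k f g => [|k IH] f g.
  by move=> fC gC x xU; exact: continuousD (fC _ xU) (gC _ xU).
move=> [fC fD] [gC gD]; split.
  by move=> x xU; exact: continuousD (fC _ xU) (gC _ xU).
move=> v; have [fd fk] := fD v; have [gd gk] := gD v; split.
  by move=> x Ux; exact: derivableD (fd _ Ux) (gd _ Ux).
by apply: eq_Ck_on (IH _ _ fk gk) => y Uy; rewrite (deriveD (fd _ Uy) (gd _ Uy)).
Qed.

Lemma Ck_onM k f g : Ck_on k U f -> Ck_on k U g -> Ck_on k U (fun x => f x * g x).
Proof.
elim: k f g => [|k IH] f g.
  by move=> fC gC x xU; exact: continuousM (fC _ xU) (gC _ xU).
move=> /[dup] fC1 [fC fD] /[dup] gC1 [gC gD]; split.
  by move=> x xU; exact: continuousM (fC _ xU) (gC _ xU).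
move=> v; have [fd fk] := fD v; have [gd gk] := gD v; split.
  by move=> x Ux; exact: derivableM (fd _ Ux) (gd _ Ux).
apply: eq_Ck_on (Ck_onD (IH _ _ (Ck_onW fC1) gk) (IH _ _ (Ck_onW gC1) fk)).
by move=> y Uy; rewrite (deriveM (fd _ Uy) (gd _ Uy)).
Qed.

Lemma Ck_onV k f : (forall x, U x -> f x != 0) -> Ck_on k U f ->
  Ck_on k U (fun x => (f x)^-1).
Proof.
move=> f0; elim: k => [|k IH].
  by move=> fC x xU; exact: continuousV (f0 _ (set_mem xU)) (fC _ xU).
move=> /[dup] fC1 [fC fD]; split.
  by move=> x xU; exact: continuousV (f0 _ (set_mem xU)) (fC _ xU).
move=> v; have [fd fk] := fD v; split.
  by move=> x Ux; exact: derivableV (f0 _ Ux) (fd _ Ux).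
(* The derivative of [1/f] is [- (1/f)^2 f'], which contains [1/f] itself, but only one order lower;
   the induction hypothesis covers that order. *)
have Vk := IH (Ck_onW fC1).
apply: eq_Ck_on (Ck_onM (Ck_onM (Ck_on_cst k (-1)) (Ck_onM Vk Vk)) fk).
move=> y Uy; rewrite (deriveV (f0 _ Uy) (fd _ Uy)).
by rewrite mulN1r -invfM -expr2.
Qed.

Lemma eq_smooth_on f g : (forall y, U y -> f y = g y) ->
  smooth_on U f -> smooth_on U g.
Proof. by move=> fg fS k; exact: eq_Ck_on fg (fS k). Qed.

Lemma smooth_on_cst (c : R) : smooth_on U (fun _ => c).
Proof. by move=> k; exact: Ck_on_cst. Qed.

Lemma smooth_onD f g : smooth_on U f -> smooth_on U g ->
  smooth_on U (fun x => f x + g x).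
Proof. by move=> fS gS k; exact: Ck_onD. Qed.

Lemma smooth_onM f g : smooth_on U f -> smooth_on U g ->
  smooth_on U (fun x => f x * g x).
Proof. by move=> fS gS k; exact: Ck_onM. Qed.

Lemma smooth_onN f : smooth_on U f -> smooth_on U (fun x => - f x).
Proof.
move=> fS; apply: eq_smooth_on (smooth_onM (smooth_on_cst (-1)) fS) => y _.
by rewrite mulN1r.
Qed.

Lemma smooth_onB f g : smooth_on U f -> smooth_on U g ->
  smooth_on U (fun x => f x - g x).
Proof. by move=> fS gS; apply: smooth_onD => //; exact: smooth_onN. Qed.

Lemma smooth_onV f : (forall x, U x -> f x != 0) -> smooth_on U f ->
  smooth_on U (fun x => (f x)^-1).
Proof. by move=> f0 fS k; exact: Ck_onV. Qed.

Lemma smooth_on_sum (I : Type) (r : seq I) (P : pred I) (F : I -> E -> R) :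
  (forall i, P i -> smooth_on U (F i)) ->
  smooth_on U (fun x => \sum_(i <- r | P i) F i x).
Proof.
move=> FS; elim: r => [|i r IH].
  by apply: eq_smooth_on (smooth_on_cst 0) => y _; rewrite big_nil.
case: (boolP (P i)) => Pi.
  by apply: eq_smooth_on (smooth_onD (FS i Pi) IH) => y _; rewrite big_cons Pi.
by apply: eq_smooth_on IH => y _; rewrite big_cons (negbTE Pi).
Qed.

Lemma smooth_on_prod (I : Type) (r : seq I) (F : I -> E -> R) :
  (forall i, smooth_on U (F i)) ->
  smooth_on U (fun x => \prod_(i <- r) F i x).
Proof.
move=> FS; elim: r => [|i r IH].
  by apply: eq_smooth_on (smooth_on_cst 1) => y _; rewrite big_nil.
by apply: eq_smooth_on (smooth_onM (FS i) IH) => y _; rewrite big_cons.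
Qed.

Lemma smooth_on_derive f v : smooth_on U f -> smooth_on U ('D_v f).
Proof. by move=> fS k; have [_ /(_ v)[]] := fS k.+1. Qed.

Lemma smooth_on_derivable f v x : smooth_on U f -> U x -> derivable f x v.
Proof. by move=> fS; have [_ /(_ v)[+ _]] := fS 1%N; apply. Qed.

Lemma smooth_on_continuous f x : smooth_on U f -> U x -> {for x, continuous f}.
Proof. by move=> /(_ 0%N) fC Ux; apply: fC; rewrite inE. Qed.

Lemma smooth_on_det n (A : E -> 'M[R]_n) :
  (forall i j, smooth_on U (fun x => A x i j)) ->
  smooth_on U (fun x => \det (A x)).
Proof.
move=> AS; apply: smooth_on_sum => s _; apply: smooth_onM.
  exact: smooth_on_cst.
exact: smooth_on_prod.
Qed.

(** By Cramer's rule the entries are cofactors over the determinant. [invmx] unfolds to this formula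
    only at invertible matrices, so the identification is made on [U]. *)
Lemma smooth_on_invmx n (A : E -> 'M[R]_n) i j :
  (forall i j, smooth_on U (fun x => A x i j)) ->
  (forall x, U x -> A x \in unitmx) ->
  smooth_on U (fun x => invmx (A x) i j).
Proof.
move=> AS Au.
have detV : smooth_on U (fun x => (\det (A x))^-1).
  apply: smooth_onV (smooth_on_det AS) => x Ux.
  by have := Au x Ux; rewrite unitmxE unitfE.
(* The indices are exchanged because the adjugate is the transposed cofactor matrix. *)
have cof : smooth_on U (fun x => cofactor (A x) j i).
  apply: smooth_onM; first exact: smooth_on_cst.
  apply: smooth_on_det => k l.
  by apply: eq_smooth_on (AS (lift j k) (lift i l)) => x _; rewrite !mxE.
apply: eq_smooth_on (smooth_onM detV cof) => x Ux.
by rewrite /invmx Au // !mxE.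
Qed.

(** * Mean values along lines and the symmetry of second derivatives *)

Lemma is_derive_line f x v (s : R) : derivable f (x + s *: v) v ->
  is_derive s 1 (fun s => f (x + s *: v)) ('D_v f (x + s *: v)).
Proof.
have E1 : (fun h : R => h^-1 *: (((fun s => f (x + s *: v)) \o shift s) (h *: 1)
     - f (x + s *: v))) =
   (fun h : R => h^-1 *: ((f \o shift (x + s *: v)) (h *: v) - f (x + s *: v))).
  apply/funext => h /=; congr (_ *: (f _ - _)).
  by rewrite [h *: 1]mulr1 scalerDl addrCA addrC -addrA.
move=> fd; split; first by rewrite /derivable E1.
by rewrite /derive E1.
Qed.

Lemma mvt_line f x v (h : R) : 0 < h ->
  (forall s, 0 <= s <= h -> derivable f (x + s *: v) v) ->
  exists2 s, 0 <= s <= h & f (x + h *: v) - f x = h * 'D_v f (x + s *: v).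
Proof.
move=> h0 fd; pose phi s := f (x + s *: v).
have [||s si] := @MVT_segment R phi (fun s => 'D_v f (x + s *: v)) 0 h (ltW h0).
- move=> s; rewrite in_itv /= => /andP[s0 sh].
  by apply: is_derive_line; apply: fd; rewrite !ltW.
- apply: derivable_within_continuous => s; rewrite in_itv /= => sh.
  by have [] := is_derive_line (fd s sh).
rewrite /phi scale0r addr0 subr0 mulrC => ->.
by exists s => //; move: si; rewrite in_itv.
Qed.

(** The mean value theorem is applied twice: along [v] to the increment [f (y + h *: w) - f y], then
    along [w] to ['D_v f]. The last hypothesis keeps the whole parallelogram inside [U]. *)
Lemma second_difference f x v w (h : R) : 0 < h -> smooth_on U f ->
  (forall s t, 0 <= s <= h -> 0 <= t <= h -> U (x + s *: v + t *: w)) ->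
  exists s t, [/\ 0 <= s <= h, 0 <= t <= h &
    f (x + h *: v + h *: w) - f (x + h *: v) - (f (x + h *: w) - f x) =
    h * (h * 'D_w ('D_v f) (x + s *: v + t *: w))].
Proof.
move=> h0 fS hU.
have h00 : 0 <= (0 : R) <= h by rewrite lexx ltW.
have hh : 0 <= h <= h by rewrite lexx ltW.
pose g y := f (y + h *: w) - f y.
have shiftd y : U (y + h *: w) -> is_derive y v (fun y => f (y + h *: w)) ('D_v f (y + h *: w)).
  move=> Uy.
  have E1 : (fun k : R => k^-1 *: (((fun y => f (y + h *: w)) \o shift y) (k *: v)
     - f (y + h *: w))) =
    (fun k : R => k^-1 *: ((f \o shift (y + h *: w)) (k *: v) - f (y + h *: w))).
    by apply/funext => k /=; congr (_ *: (f _ - _)); rewrite addrA.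
  split; first by rewrite /derivable E1; exact: smooth_on_derivable.
  by rewrite /derive E1.
have gd y : U y -> U (y + h *: w) ->
   is_derive y v g ('D_v f (y + h *: w) - 'D_v f y).
  move=> Uy Uyw; apply: is_deriveB; first exact: shiftd.
  by apply: derivableP; exact: smooth_on_derivable.
have Uv s : 0 <= s <= h -> U (x + s *: v).
  by move=> /hU/(_ h00); rewrite scale0r addr0.
have [s sh gE] := @mvt_line g x v h h0 (fun s sh => ltac:(by have [] := gd (x + s *: v) (Uv _ sh) (hU _ _ sh hh))).
have [t th gE'] := @mvt_line ('D_v f) (x + s *: v) w h h0 (fun t th =>
  smooth_on_derivable (smooth_on_derive v fS) (hU _ _ sh th)).
exists s, t; split => //; rewrite -gE'.
have [_ <-] := gd (x + s *: v) (Uv _ sh) (hU _ _ sh hh).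
by rewrite -gE.
Qed.

(* By the mean value theorem the second difference of f along h v and h w is both
   h^2 D_w D_v f and h^2 D_v D_w f at points tending to x with h. *)
Lemma schwarz f v w x : smooth_on U f -> U x ->
  'D_w ('D_v f) x = 'D_v ('D_w f) x.
Proof.
move=> fS Ux; apply/eqP; rewrite -subr_eq0; apply/negPn/negP => neq.
(* Half the supposed gap: two errors below [e] cannot add up to the gap. *)
set e := `|'D_w ('D_v f) x - 'D_v ('D_w f) x| / 2.
have e0 : 0 < e by rewrite divr_gt0 ?normr_gt0.
have cA := smooth_on_continuous (smooth_on_derive w (smooth_on_derive v fS)) Ux.
have cB := smooth_on_continuous (smooth_on_derive v (smooth_on_derive w fS)) Ux.
have nA : \forall y \near x, [/\ U y, `|'D_w ('D_v f) x - 'D_w ('D_v f) y| < e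
   & `|'D_v ('D_w f) x - 'D_v ('D_w f) y| < e].
  have nU : \near x, U x by exact: open_nbhs_nbhs.
  have dA : \forall y \near x, `|'D_w ('D_v f) x - 'D_w ('D_v f) y| < e.
    by move/cvgrPdist_lt: cA; apply.
  have dB : \forall y \near x, `|'D_v ('D_w f) x - 'D_v ('D_w f) y| < e.
    by move/cvgrPdist_lt: cB; apply.
  by apply: filterS3 nU dA dB.
have [r /= r0 rP] := (nbhs_normP _ _).1 nA.
(* The summand 1 keeps [K] positive even if [v] and [w] vanish. With [h = r / 2 / K] every point of
   the parallelogram lies within [r / 2] of [x]. *)
set K := `|v| + `|w| + 1.
have K0 : 0 < K by rewrite ltr_wpDl ?addr_ge0.
pose h := r / 2 / K.
have h0 : 0 < h by rewrite !divr_gt0.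
have hP s t : 0 <= s <= h -> 0 <= t <= h ->
  [/\ U (x + s *: v + t *: w),
   `|'D_w ('D_v f) x - 'D_w ('D_v f) (x + s *: v + t *: w)| < e &
   `|'D_v ('D_w f) x - 'D_v ('D_w f) (x + s *: v + t *: w)| < e].
  move=> /andP[s0 sh] /andP[t0 th]; apply: rP; rewrite /ball_ /=.
  rewrite -addrA opprD addNKr normrN.
  apply: le_lt_trans (ler_normD _ _) _; rewrite !normrZ !ger0_norm //.
  apply: (@le_lt_trans _ _ (h * K)).
    by rewrite /K !mulrDr mulr1 ler_wpDr ?(ltW h0) // lerD ?ler_wpM2r.
  by rewrite /h divfK ?gt_eqF // ltr_pdivrMr // mulr_natr mulr2n ltrDl.
have [s [t [sh th E1]]] := second_difference h0 fS (fun s t sh th => let: And3 H _ _ := hP s t sh th in H).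
have swap s' t' : x + s' *: w + t' *: v = x + t' *: v + s' *: w by rewrite addrAC.
have [|t' [s' [th' sh' E2]]] := @second_difference f x w v h h0 fS.
  by move=> s' t' sh' th'; rewrite swap; have [] := hP _ _ th' sh'.
(* The second difference is symmetric in [v] and [w], so both mean value expressions equal it; the
   factor [h] is then cancelled twice. *)
have EE : 'D_w ('D_v f) (x + s *: v + t *: w) = 'D_v ('D_w f) (x + s' *: v + t' *: w).
  apply: (mulfI (lt0r_neq0 h0)); apply: (mulfI (lt0r_neq0 h0)).
  rewrite -(swap t' s'); apply: etrans (esym E1) _; apply: etrans _ E2.
  rewrite (swap h h); move: (f _) (f (x + _)) (f (x + _)) (f x) => a b c d; ring.
have [_ dA _] := hP _ _ sh th; have [_ _ dB] := hP _ _ sh' th'.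
have : `|'D_w ('D_v f) x - 'D_v ('D_w f) x| < e + e.
  apply: le_lt_trans (ltrD dA dB).
  by rewrite EE [X in _ <= _ + X]distrC; exact: ler_distD.
by rewrite /e -splitr ltxx.
Qed.

End SmoothCalculus.

(** * The adapted frame fields as derivations of smooth functions *)

Section AdaptedFrame.
Context (R : realType) (n : nat) (U : set (tpt R n)).
Context (N : 'I_n -> 'I_n -> tpt R n -> R).
Context (openU : open U).
Context (smoothN : forall a mu, smooth_on U (N a mu)).
Implicit Types (f g : tpt R n -> R) (G : dconn R n) (p : tpt R n).

Lemma smooth_on_frame t c f : smooth_on U f -> smooth_on U (frame N t c f).
Proof.
move=> fS; case: t; last exact: smooth_on_derive.
apply: smooth_onB => //; first exact: smooth_on_derive.
apply: smooth_on_sum => // a _; apply: smooth_onM => //.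
exact: smooth_on_derive.
Qed.

Lemma eq_on_frame t c f g p : (forall q, U q -> f q = g q) -> U p ->
  frame N t c f p = frame N t c g p.
Proof.
move=> fg Up; case: t; rewrite /= /ddx /ddy.
  rewrite (eq_on_derive openU _ fg Up); congr (_ - _).
  by apply: eq_bigr => a _; rewrite (eq_on_derive openU _ fg Up).
by rewrite (eq_on_derive openU _ fg Up).
Qed.

Lemma frame_cst t c (r : R) p : frame N t c (fun _ => r) p = 0.
Proof.
have D0 v : 'D_v (fun _ : tpt R n => r) p = 0 by exact: (derive_cst r).
case: t; rewrite /= /ddx /ddy D0 // big1 ?subr0 // => a _.
by rewrite D0 mulr0.
Qed.

Lemma frameD t c f g p : smooth_on U f -> smooth_on U g -> U p ->
  frame N t c (fun q => f q + g q) p = frame N t c f p + frame N t c g p.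
Proof.
move=> fS gS Up.
have DD v : 'D_v (fun q => f q + g q) p = 'D_v f p + 'D_v g p.
  by apply: deriveD; exact: smooth_on_derivable Up.
case: t; rewrite /= /ddx /ddy DD //.
under eq_bigr do rewrite DD mulrDr.
by rewrite big_split opprD addrACA.
Qed.

Lemma frameM t c f g p : smooth_on U f -> smooth_on U g -> U p ->
  frame N t c (fun q => f q * g q) p =
  f p * frame N t c g p + frame N t c f p * g p.
Proof.
move=> fS gS Up.
have DM v : 'D_v (fun q => f q * g q) p = f p * 'D_v g p + 'D_v f p * g p.
  rewrite [_ * g p]mulrC.
  by apply: deriveM; exact: smooth_on_derivable Up.
case: t; rewrite /= /ddx /ddy DM //.
under eq_bigr do rewrite DM mulrDr mulrCA [N _ _ _ * (_ * g p)]mulrA.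
rewrite big_split /= -mulr_sumr -mulr_suml; ring.
Qed.

Lemma frameN t c f p : smooth_on U f -> U p ->
  frame N t c (fun q => - f q) p = - frame N t c f p.
Proof.
move=> fS Up; apply/eqP; rewrite -addr_eq0; apply/eqP.
rewrite -frameD //; last exact: smooth_onN.
rewrite -[RHS](frame_cst t c 0 p); apply: eq_on_frame => // q _.
by rewrite addNr.
Qed.

Lemma frame_sum t c (I : Type) (r : seq I) (F : I -> tpt R n -> R) p :
  (forall i, smooth_on U (F i)) -> U p ->
  frame N t c (fun q => \sum_(i <- r) F i q) p =
  \sum_(i <- r) frame N t c (F i) p.
Proof.
move=> FS Up; elim: r => [|i r IH].
  rewrite big_nil -[RHS](frame_cst t c 0 p).
  by apply: eq_on_frame => // q _; rewrite big_nil.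
rewrite big_cons -IH -frameD //; last exact: smooth_on_sum.
by apply: eq_on_frame => // q _; rewrite big_cons.
Qed.

(** * Vertical curvature in coordinates and the vertical Ricci identity *)

Lemma Scurv_coordinates G t a b c d p :
  Scurv N G t a b c d p =
  (ddy c (G t Ver a b d) p - ddy d (G t Ver a b c) p)
  + (\sum_e G t Ver e b d p * G t Ver a e c p
     - \sum_e G t Ver e b c p * G t Ver a e d p).
Proof.
have ddy_cst (e : 'I_n) (r : R) q : ddy e (fun _ => r) q = 0 by exact: (frame_cst Ver e r q).
have vactVer (e : 'I_n) f q : vact N (@frame_field R n Ver e) f q = ddy e f q.
  rewrite /vact big1 ?add0r => [|i _]; last by rewrite mul0r.
  rewrite (bigD1 e) //= eqxx mul1r big1 ?addr0 // => i /negbTE ie.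
  by rewrite ie mul0r.
have sumVer (e : 'I_n) s (e' e'' : 'I_n) q :
    \sum_c0 @frame_field R n Ver e Hor c0 q * G s Hor e' e'' c0 q
    + \sum_c0 @frame_field R n Ver e Ver c0 q * G s Ver e' e'' c0 q
    = G s Ver e' e'' e q.
  rewrite big1 ?add0r => [|i _]; last by rewrite mul0r.
  rewrite (bigD1 e) //= eqxx mul1r big1 ?addr0 // => i /negbTE ie.
  by rewrite ie mul0r.
(* Stated as an equality of functions, since the outer [nabla] in [nab2] differentiates it. *)
have nab1 (e f : 'I_n) :
    nabla N G (@frame_field R n Ver e) (@frame_field R n t b) t f = G t Ver f b e.
  apply/funext => q; rewrite /nabla vactVer.
  have -> : @frame_field R n t b t f = fun _ => (f == b)%:R by case: (t).
  rewrite ddy_cst add0r.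
  under eq_bigr do rewrite sumVer.
  have E i : @frame_field R n t b t i q = (i == b)%:R by case: (t).
  rewrite (bigD1 b) //= E eqxx mul1r big1 ?addr0 // => i /negbTE ib.
  by rewrite E ib mul0r.
have nab2 (e f : 'I_n) : nabla N G (@frame_field R n Ver e)
    (nabla N G (@frame_field R n Ver f) (@frame_field R n t b)) t a p =
    ddy e (G t Ver a b f) p + \sum_i G t Ver i b f p * G t Ver a i e p.
  rewrite {1}/nabla vactVer nab1; congr (_ + _).
  by apply: eq_bigr => i _; rewrite sumVer nab1.
(* A vertical frame field has zero horizontal part, so [N] drops out and its natural components are
   constants; every derivative in the bracket is then zero. *)
have lieE s e : lie_bracket N (@frame_field R n Ver c) (@frame_field R n Ver d) s e p = 0.
  have nat_cst (i : 'I_n) s' (f : 'I_n) : exists r : R,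
      to_natural N (@frame_field R n Ver i) s' f = fun _ => r.
    case: s'; first by exists 0; apply/funext.
    exists (f == i)%:R; apply/funext => q /=.
    by rewrite big1 ?subr0 // => j _; rewrite mulr0.
  have dnat (i j : 'I_n) s' (f : 'I_n) :
      vact N (@frame_field R n Ver i) (to_natural N (@frame_field R n Ver j) s' f) p = 0.
    by have [r ->] := nat_cst j s' f; rewrite vactVer ddy_cst.
  case: s; rewrite /lie_bracket /= !dnat subrr // add0r big1 // => mu _.
  by rewrite !dnat subrr mulr0.
rewrite /Scurv /curvature !nab2.
have -> : nabla N G (lie_bracket N (@frame_field R n Ver c) (@frame_field R n Ver d))
    (@frame_field R n t b) t a p = 0.
  rewrite /nabla /vact !big1 ?addr0 // => i _; rewrite ?lieE ?mul0r //.
  by rewrite !big1 ?addr0 ?mulr0 // => j _; rewrite lieE mul0r.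
ring.
Qed.

(** The derivative in direction [d] is the outer one in the first term, so the commutator is the
    curvature on the pair [d], [c]; this is the source of the reversed last indices in (e) and
    (f). *)
Lemma vertical_ricci G t (T : 'I_n -> tpt R n -> R) a c d p :
  (forall t s a b c, smooth_on U (G t s a b c)) ->
  (forall a b c p, G Ver Ver a b c p = G Ver Ver a c b p) ->
  (forall a, smooth_on U (T a)) -> U p ->
  cov11 N G t Ver Ver (cov10 N G t Ver T) a c d p
  - cov11 N G t Ver Ver (cov10 N G t Ver T) a d c p
  = \sum_e T e p * Scurv N G t a e d c p.
Proof.
move=> GS Gsym TS Up.
have frame_cov (b e : 'I_n) : frame N Ver e (cov10 N G t Ver T a b) p =
    ddy e (ddy b (T a)) p + (\sum_i T i p * ddy e (G t Ver a i b) p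
      + \sum_i ddy e (T i) p * G t Ver a i b p).
  have TG i : smooth_on U (fun q => T i q * G t Ver a i b q) by exact: smooth_onM.
  rewrite frameD //; [|exact: smooth_on_frame|exact: smooth_on_sum].
  rewrite frame_sum //; congr (_ + _).
  under eq_bigr do rewrite frameM //.
  by rewrite big_split.
have -> : \sum_e T e p * Scurv N G t a e d c p =
  (\sum_e T e p * ddy d (G t Ver a e c) p - \sum_e T e p * ddy c (G t Ver a e d) p)
  + (\sum_e (\sum_i T i p * G t Ver e i c p) * G t Ver a e d p
    - \sum_e (\sum_i T i p * G t Ver e i d p) * G t Ver a e c p).
  have X (b e : 'I_n) : \sum_i (\sum_j T j p * G t Ver i j b p) * G t Ver a i e p =
     \sum_j T j p * \sum_i G t Ver i j b p * G t Ver a i e p.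
    under eq_bigr do rewrite mulr_suml.
    rewrite exchange_big; apply: eq_bigr => j _; rewrite mulr_sumr.
    by apply: eq_bigr => i _; rewrite mulrA.
  rewrite !X -!sumrB -big_split; apply: eq_bigr => e _ /=.
  rewrite Scurv_coordinates; ring.
(* Vertical frame derivatives are plain directional derivatives along fixed vectors, so Schwarz's
   theorem applies directly. *)
have swapD : ddy d (ddy c (T a)) p = ddy c (ddy d (T a)) p by exact: (schwarz openU).
(* The symmetry of [G Ver Ver] cancels the terms that act on the derivative index, leaving no
   torsion contribution. *)
have GG : \sum_e cov10 N G t Ver T a e p * G Ver Ver e c d p =
   \sum_e cov10 N G t Ver T a e p * G Ver Ver e d c p.
  by apply: eq_bigr => e _; rewrite Gsym.
have TT (b e : 'I_n) : \sum_i cov10 N G t Ver T i b p * G t Ver a i e p =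
   \sum_i ddy b (T i) p * G t Ver a i e p
   + \sum_i (\sum_j T j p * G t Ver i j b p) * G t Ver a i e p.
  by rewrite -big_split; apply: eq_bigr => i _ /=; rewrite -mulrDl.
rewrite /cov11 !frame_cov GG !TT swapD; ring.
Qed.

(** * The mesh, its metric, and the flatness of the canonical connection *)

Section Mesh.
Context (lam : 'I_n -> hv -> 'I_n -> tpt R n -> R).
Context (smooth_lam : forall i t a, smooth_on U (lam i t a)).
Context (indep_lam : forall t p, U p -> row_free (mesh_mx lam t p)).

Local Notation D := (canonical_dconn N lam).
Local Notation D0 := (natural_dconn N lam).
Local Notation gam := (contortion N lam).

Lemma mesh_unit t p : U p -> mesh_mx lam t p \in unitmx.
Proof. by rewrite -row_free_unit; exact: indep_lam. Qed.

Lemma mesh_comesh t i j p : U p ->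
  \sum_a lam i t a p * comesh lam j t a p = (i == j)%:R.
Proof.
move=> Up; have /matrixP/(_ i j) := mulmxV (mesh_unit t Up).
by rewrite !mxE => <-; apply: eq_bigr => a _; rewrite !mxE.
Qed.

Lemma comesh_mesh t a b p : U p ->
  \sum_i lam i t a p * comesh lam i t b p = (a == b)%:R.
Proof.
move=> Up; have /matrixP/(_ b a) := mulVmx (mesh_unit t Up).
rewrite !mxE eq_sym => <-; apply: eq_bigr => i _; rewrite !mxE.
by rewrite mulrC.
Qed.

(** Contracting with the inverse mesh recovers each component. This strips the mesh vectors from the
    identities that define the W-tensors. *)
Lemma mesh_inj t p (X Y : 'I_n -> R) : U p ->
  (forall i, \sum_e lam i t e p * X e = \sum_e lam i t e p * Y e) -> X =1 Y.
Proof.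
move=> Up XY.
have E (Z : 'I_n -> R) b : Z b = \sum_i comesh lam i t b p * \sum_e lam i t e p * Z e.
  under eq_bigr do rewrite mulr_sumr.
  rewrite exchange_big /= (eq_bigr (fun e => (e == b)%:R * Z e)).
    rewrite (bigD1 b) //= eqxx mul1r big1 ?addr0 // => e /negbTE ->.
    by rewrite mul0r.
  move=> e _; rewrite -(comesh_mesh t e b Up) mulr_suml.
  by apply: eq_bigr => i _; rewrite mulrCA mulrA.
by move=> b; rewrite [LHS]E [RHS]E; apply: eq_bigr => i _; rewrite XY.
Qed.

Lemma smooth_comesh i t a : smooth_on U (comesh lam i t a).
Proof.
apply: smooth_on_invmx => // [j b|p Up]; last exact: mesh_unit.
by apply: eq_smooth_on (smooth_lam j t b) => // p _; rewrite mxE.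
Qed.

Lemma smooth_metric t a b : smooth_on U (metric lam t a b).
Proof.
apply: smooth_on_sum => // i _.
by apply: smooth_onM => //; exact: smooth_comesh.
Qed.

Lemma smooth_cometric t a b : smooth_on U (cometric lam t a b).
Proof.
apply: smooth_on_invmx => // [c d|p Up].
  by apply: eq_smooth_on (smooth_metric t c d) => // p _; rewrite mxE.
(* The metric matrix is [B B^T] with [B] the inverse of the mesh matrix, hence invertible. *)
have -> : \matrix_(c, d) metric lam t c d p =
    invmx (mesh_mx lam t p) *m (invmx (mesh_mx lam t p))^T.
  by apply/matrixP => c d; rewrite !mxE; apply: eq_bigr => i _; rewrite mxE.
by rewrite unitmx_mul unitmx_tr unitmx_inv mesh_unit.
Qed.

Lemma smooth_natural t s a b c : smooth_on U (D0 t s a b c).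
Proof.
have fS t' c' f : smooth_on U f -> smooth_on U (frame N t' c' f).
  exact: smooth_on_frame.
have dN d' c' b' : smooth_on U (ddy b' (N d' c')) by exact: (fS Ver).
have gS t' a' b' := smooth_metric t' a' b'.
have ggS t' a' b' := smooth_cometric t' a' b'.
have dg t' a' b' c' : smooth_on U (ddy c' (metric lam t' a' b')).
  exact: (fS Ver).
have sc := smooth_on_cst openU.
have sumM (F F' : 'I_n -> tpt R n -> R) :
    (forall i, smooth_on U (F i)) -> (forall i, smooth_on U (F' i)) ->
    smooth_on U (fun q => \sum_i F i q * F' i q).
  by move=> FS F'S; apply: smooth_on_sum => // i _; exact: smooth_onM.
have half F F' : (forall i, smooth_on U (F i)) -> (forall i, smooth_on U (F' i)) ->
    smooth_on U (fun q => 2^-1 * \sum_(i < n) F i q * F' i q).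
  by move=> FS F'S; apply: smooth_onM => //; exact: sumM.
case: t; case: s.
- apply: half => // i; apply: smooth_onB => //; last exact: fS.
  by apply: smooth_onD => //; exact: fS.
- exact: half.
- apply: smooth_onD => //; apply: half => // i.
  apply: smooth_onB => //; last exact: sumM.
  by apply: smooth_onB => //; [exact: fS|exact: sumM].
- apply: half => // i; apply: smooth_onB => //.
  exact: smooth_onD.
Qed.

Lemma smooth_canonical t s a b c : smooth_on U (D t s a b c).
Proof.
apply: smooth_on_sum => // i _; apply: smooth_onM => //.
by apply: smooth_on_frame; exact: smooth_comesh.
Qed.

Lemma smooth_contortion t s a b c : smooth_on U (gam t s a b c).
Proof.
by apply: smooth_onB => //; [exact: smooth_canonical|exact: smooth_natural].
Qed.

Lemma metricC t a b : metric lam t a b = metric lam t b a.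
Proof. by apply/funext => p; apply: eq_bigr => i _; rewrite mulrC. Qed.

(** Both diagonal blocks have the form of Christoffel symbols of a symmetric metric. The case [Hor]
    produces the torsion of D in (a) and (b); the case [Ver] feeds the Ricci identity behind (e) and
    (f). *)
Lemma naturalC t a b c p : D0 t t a b c p = D0 t t a c b p.
Proof.
case: t; congr (_ * _); apply: eq_bigr => e _; rewrite (metricC _ b c);
  congr (_ * (_ - _)); exact: addrC.
Qed.

(** This is the equation D lambda = 0 solved for the frame derivative. The coefficients of D involve
    derivatives of the inverse mesh, and the duality relation transfers these to the mesh itself. *)
Lemma frame_mesh i t s a c p : U p ->
  frame N s c (lam i t a) p = - \sum_e lam i t e p * D t s a e c p.
Proof.
move=> Up.
(* derivative of lambda_i^e lambda_{je} = delta_{ij} *)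
have diff0 j : \sum_e lam i t e p * frame N s c (comesh lam j t e) p =
    - \sum_e frame N s c (lam i t e) p * comesh lam j t e p.
  apply/eqP; rewrite -addr_eq0 -big_split /=; apply/eqP.
  have LC e : smooth_on U (fun q => lam i t e q * comesh lam j t e q).
    by apply: smooth_onM => //; exact: smooth_comesh.
  transitivity (frame N s c
      (fun q => \sum_e lam i t e q * comesh lam j t e q) p).
    rewrite frame_sum //; apply: eq_bigr => e _.
    by rewrite frameM //; exact: smooth_comesh.
  rewrite -[RHS](frame_cst s c (i == j)%:R p).
  by apply: eq_on_frame => // q Uq; rewrite mesh_comesh.
(* The other duality relation, summed over the mesh index [j], turns the product of [lam j] and
   [comesh lam j] into a Kronecker delta and isolates the component [a]. *)
transitivity (\sum_j lam j t a p *
    \sum_e frame N s c (lam i t e) p * comesh lam j t e p).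
  under eq_bigr do rewrite mulr_sumr.
  rewrite exchange_big /=.
  rewrite (eq_bigr (fun e => (a == e)%:R * frame N s c (lam i t e) p)); last first.
    move=> e _; rewrite -(comesh_mesh t a e Up) mulr_suml.
    by apply: eq_bigr => j _; rewrite mulrCA mulrC.
  rewrite (bigD1 a) //= eqxx mul1r big1 ?addr0 // => e.
  by rewrite eq_sym => /negbTE ->; rewrite mul0r.
rewrite -sumrN.
under eq_bigr do rewrite -[\sum_e _]opprK -diff0 mulrN mulr_sumr -sumrN.
rewrite exchange_big; apply: eq_bigr => e _ /=.
rewrite mulr_sumr -sumrN; apply: eq_bigr => j _.
by rewrite mulrCA.
Qed.

(** * Second covariant derivatives of the mesh in terms of the contortion *)

Lemma cov10_mesh i t s a c p : U p ->
  cov10 N D0 t s (lam i t) a c p = - \sum_e lam i t e p * gam t s a e c p.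
Proof.
move=> Up; rewrite /cov10 frame_mesh // addrC -sumrN -sumrN -big_split.
apply: eq_bigr => e _ /=; rewrite /contortion; ring.
Qed.

(** Each index of the contortion gets its D-term differently: the one contracted with the mesh from
    differentiating the mesh vector, the upper and the last lower one from D0 plus contortion. Kinds
    [s] and [s'] stay arbitrary so that the mixed commutators are included. *)
Lemma cov11_cov10_mesh i t s s' a c d p : U p ->
  cov11 N D0 t s s' (cov10 N D0 t s (lam i t)) a c d p =
  \sum_b lam i t b p *
    (- cov12 N D t t s s' (gam t s) a b c d p
     + \sum_e gam t s e b c p * gam t s' a e d p
     - \sum_e gam s s' e c d p * gam t s a b e p).
Proof.
move=> Up; rewrite /cov11.
have -> : frame N s' d (cov10 N D0 t s (lam i t) a c) p =
    \sum_b lam i t b p * (- frame N s' d (gam t s a b c) p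
                          + \sum_e gam t s a e c p * D t s' e b d p).
  have LG e : smooth_on U (fun q => lam i t e q * gam t s a e c q).
    by apply: smooth_onM => //; exact: smooth_contortion.
  (* The formula for the first derivative holds on [U], which is open, so it may be differentiated
     there. *)
  rewrite (@eq_on_frame _ _ _ (fun q => - \sum_e lam i t e q * gam t s a e c q)) //;
    last by move=> q Uq; exact: cov10_mesh.
  rewrite frameN //; last exact: smooth_on_sum.
  rewrite frame_sum //.
  have fM e : frame N s' d (fun q => lam i t e q * gam t s a e c q) p =
      lam i t e p * frame N s' d (gam t s a e c) p
      + (- \sum_b lam i t b p * D t s' e b d p) * gam t s a e c p.
    by rewrite frameM ?frame_mesh //; exact: smooth_contortion.
  under eq_bigr do rewrite fM.
  rewrite big_split opprD -sumrN.
  under [RHS]eq_bigr do rewrite mulrDr mulrN.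
  rewrite big_split; congr (_ + _); rewrite -sumrN /=.
  under eq_bigr do rewrite mulNr opprK mulr_suml.
  rewrite exchange_big; apply: eq_bigr => b _ /=.
  by rewrite mulr_sumr; apply: eq_bigr => e _; rewrite -mulrA [D _ _ _ _ _ _ * _]mulrC.
have -> : \sum_e cov10 N D0 t s (lam i t) e c p * D0 t s' a e d p =
    \sum_b lam i t b p * - (\sum_e gam t s e b c p * D0 t s' a e d p).
  under eq_bigr do rewrite cov10_mesh // mulNr mulr_suml -sumrN.
  rewrite exchange_big; apply: eq_bigr => b _ /=.
  by rewrite mulrN mulr_sumr -sumrN; apply: eq_bigr => e _; rewrite mulrA.
have -> : \sum_e cov10 N D0 t s (lam i t) a e p * D0 s s' e c d p =
    \sum_b lam i t b p * - (\sum_e gam t s a b e p * D0 s s' e c d p).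
  under eq_bigr do rewrite cov10_mesh // mulNr mulr_suml -sumrN.
  rewrite exchange_big; apply: eq_bigr => b _ /=.
  by rewrite mulrN mulr_sumr -sumrN; apply: eq_bigr => e _; rewrite mulrA.
rewrite -big_split -sumrB; apply: eq_bigr => b _ /=.
(* Writing D as D0 plus contortion in these two slots creates quadratic terms, exactly those that
   the claimed formula adds to and subtracts from [cov12]. *)
have split1 : \sum_e gam t s e b c p * D t s' a e d p =
    \sum_e gam t s e b c p * gam t s' a e d p
    + \sum_e gam t s e b c p * D0 t s' a e d p.
  rewrite -big_split; apply: eq_bigr => e _ /=.
  by rewrite -mulrDr /contortion subrK.
have split2 : \sum_e gam t s a b e p * D s s' e c d p =
    \sum_e gam s s' e c d p * gam t s a b e p
    + \sum_e gam t s a b e p * D0 s s' e c d p.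
  rewrite -big_split; apply: eq_bigr => e _ /=.
  by rewrite [X in X + _]mulrC -mulrDr /contortion subrK.
rewrite /cov12 split1 split2; ring.
Qed.

(* [s] and [s'] are the kinds of [c] and [d], [t] that of [a] and [b]. *)
Definition contortion_curvature (s s' t : hv) (a b c d : 'I_n) (p : tpt R n) : R :=
  (cov12 N D t t s' s (gam t s') a b d c p
   - cov12 N D t t s s' (gam t s) a b c d p)
  + (\sum_e gam t s e b c p * gam t s' a e d p
     - \sum_e gam t s' e b d p * gam t s a e c p)
  + (\sum_e gam s' s e d c p * gam t s' a b e p
     - \sum_e gam s s' e c d p * gam t s a b e p).

Lemma mesh_ricci i t s s' a c d p : U p ->
  cov11 N D0 t s s' (cov10 N D0 t s (lam i t)) a c d p
  - cov11 N D0 t s' s (cov10 N D0 t s' (lam i t)) a d c p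
  = \sum_b lam i t b p * contortion_curvature s s' t a b c d p.
Proof.
move=> Up; rewrite !cov11_cov10_mesh // -sumrB; apply: eq_bigr => b _.
rewrite /contortion_curvature; ring.
Qed.

(** In the difference of the contortions with [c] and [d] exchanged, the D0 parts cancel by
    symmetry, leaving minus the torsion of D. *)
Lemma contortion_curvature_hh t a b c d p :
  contortion_curvature Hor Hor t a b c d p =
  (cov12 N D t t Hor Hor (gam t Hor) a b d c p
   - cov12 N D t t Hor Hor (gam t Hor) a b c d p)
  + (\sum_e gam t Hor e b c p * gam t Hor a e d p
     - \sum_e gam t Hor e b d p * gam t Hor a e c p)
  - \sum_e gam t Hor a b e p * htorsion N lam e c d p.
Proof.
congr (_ + _); rewrite -sumrB -sumrN; apply: eq_bigr => e _.
rewrite /contortion /htorsion (naturalC Hor e d c); ring.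
Qed.

(** One direction removes the mesh vectors by their independence, the other contracts with them. The
    [vv] block goes through the Ricci identity of D0, the other two through the contortion. *)
Lemma is_wtensorsE (W : wtensors R n) :
  is_wtensors N lam U D0 W <->
  forall p t a b c d, U p ->
  [/\ W_hh W t a b c d p = contortion_curvature Hor Hor t a b c d p,
      W_hv W t a b c d p = contortion_curvature Hor Ver t a b c d p &
      W_vv W t a b c d p = Scurv N D0 t a b d c p].
Proof.
have vv i t a c d p : U p ->
    cov11 N D0 t Ver Ver (cov10 N D0 t Ver (lam i t)) a c d p
    - cov11 N D0 t Ver Ver (cov10 N D0 t Ver (lam i t)) a d c p
    = \sum_b lam i t b p * Scurv N D0 t a b d c p.
  by apply: vertical_ricci => // *; [exact: smooth_natural|exact: naturalC].
split=> [WP p t a b c d Up|WP p i t a c d Up]; last first.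
  split; [rewrite mesh_ricci //|rewrite mesh_ricci //|rewrite vv //];
    apply: eq_bigr => b _; congr (_ * _);
    by have [E1 E2 E3] := WP p t a b c d Up.
split.
- apply: (mesh_inj (t := t) Up (X := fun b => W_hh W t a b c d p)
    (Y := fun b => contortion_curvature Hor Hor t a b c d p)) => i.
  by have [<- _ _] := WP p i t a c d Up; rewrite mesh_ricci.
- apply: (mesh_inj (t := t) Up (X := fun b => W_hv W t a b c d p)
    (Y := fun b => contortion_curvature Hor Ver t a b c d p)) => i.
  by have [_ <- _] := WP p i t a c d Up; rewrite mesh_ricci.
- apply: (mesh_inj (t := t) Up (X := fun b => W_vv W t a b c d p)
    (Y := fun b => Scurv N D0 t a b d c p)) => i.
  by have [_ _ <-] := WP p i t a c d Up; rewrite vv.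
Qed.

End Mesh.
End AdaptedFrame.

(** The equivalence carries existence as well as uniqueness: over any induced chart, components
    given by (a)-(f) satisfy the defining relations, and no others do. *)
Theorem theorem4p2 (R : realType) (n : nat) (M : smooth_manifold R n)
    (N : nonlinear_connection M) (lam : eap_space N) (k : chart M)
    (W : wtensors R n) :
  let D := canonical_dconn (N k) (lam k) in
  let D0 := natural_dconn (N k) (lam k) in
  let gam := contortion (N k) (lam k) in
  let Lam := htorsion (N k) (lam k) in
  let S0 := Scurv (N k) D0 in
  is_wtensors (N k) (lam k) (tdom k) D0 W
  <->
  forall p : tpt R n, tdom k p ->
  [/\ (forall al be nu mu : 'I_n,
        W_hh W Hor al be nu mu p =
        (cov12 (N k) D Hor Hor Hor Hor (gam Hor Hor) al be mu nu p
         - cov12 (N k) D Hor Hor Hor Hor (gam Hor Hor) al be nu mu p)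
        + (\sum_(e < n) gam Hor Hor e be nu p * gam Hor Hor al e mu p
           - \sum_(e < n) gam Hor Hor e be mu p * gam Hor Hor al e nu p)
        - \sum_(e < n) gam Hor Hor al be e p * Lam e nu mu p),
      (forall a b nu mu : 'I_n,
        W_hh W Ver a b nu mu p =
        (cov12 (N k) D Ver Ver Hor Hor (gam Ver Hor) a b mu nu p
         - cov12 (N k) D Ver Ver Hor Hor (gam Ver Hor) a b nu mu p)
        + (\sum_(d < n) gam Ver Hor d b nu p * gam Ver Hor a d mu p
           - \sum_(d < n) gam Ver Hor d b mu p * gam Ver Hor a d nu p)
        - \sum_(e < n) gam Ver Hor a b e p * Lam e nu mu p) &
      [/\ (forall al be nu c : 'I_n,
            W_hv W Hor al be nu c p =
            (cov12 (N k) D Hor Hor Ver Hor (gam Hor Ver) al be c nu p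
             - cov12 (N k) D Hor Hor Hor Ver (gam Hor Hor) al be nu c p)
            + (\sum_(e < n) gam Hor Hor e be nu p * gam Hor Ver al e c p
               - \sum_(e < n) gam Hor Ver e be c p * gam Hor Hor al e nu p)
            + (\sum_(d < n) gam Ver Hor d c nu p * gam Hor Ver al be d p
               - \sum_(e < n) gam Hor Ver e nu c p * gam Hor Hor al be e p)),
          (forall a b nu c : 'I_n,
            W_hv W Ver a b nu c p =
            (cov12 (N k) D Ver Ver Ver Hor (gam Ver Ver) a b c nu p
             - cov12 (N k) D Ver Ver Hor Ver (gam Ver Hor) a b nu c p)
            + (\sum_(d < n) gam Ver Hor d b nu p * gam Ver Ver a d c p
               - \sum_(d < n) gam Ver Ver d b c p * gam Ver Hor a d nu p)
            + (\sum_(d < n) gam Ver Hor d c nu p * gam Ver Ver a b d p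
               - \sum_(e < n) gam Hor Ver e nu c p * gam Ver Hor a b e p)),
          (forall al be b c : 'I_n,
            W_vv W Hor al be b c p = S0 Hor al be c b p) &
          (forall a b c d : 'I_n,
            W_vv W Ver a b c d p = S0 Ver a b d c p)]].
Proof.
have openU : open (tdom k).
  apply: (@open_comp _ _ (fst : tpt R n -> 'rV[R]_n) (ch_map k @` ch_dom k)%classic).
    by move=> x _; exact: cvg_fst.
  exact: ch_img_open.
have smoothN a mu : smooth_on (tdom k) (N k a mu) by exact: nlc_smooth.
have smooth_lam i t a : smooth_on (tdom k) (lam k i t a) by exact: mesh_smooth.
have indep t p : tdom k p -> row_free (mesh_mx (lam k) t p).
  exact: mesh_indep.
move=> D D0 gam Lam S0.
have WE := is_wtensorsE openU smoothN smooth_lam indep W.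
split=> [/WE WP p Up|WP].
  split=> [al be nu mu|a b nu mu|].
  - by have [-> _ _] := WP p Hor al be nu mu Up; rewrite contortion_curvature_hh.
  - by have [-> _ _] := WP p Ver a b nu mu Up; rewrite contortion_curvature_hh.
  (* The right-hand sides of (c) and (d) are [contortion_curvature Hor Ver] up to conversion; only
     (a) and (b) required the torsion rewriting. *)
  split=> [al be nu c|a b nu c|al be b c|a b c d].
  - by have [_ -> _] := WP p Hor al be nu c Up.
  - by have [_ -> _] := WP p Ver a b nu c Up.
  - by have [_ _ ->] := WP p Hor al be b c Up.
  - by have [_ _ ->] := WP p Ver a b c d Up.
apply/WE => p t a b c d Up; have [hhH hhV [hvH hvV vvH vvV]] := WP p Up.
rewrite contortion_curvature_hh; case: t; split.
- exact: hhH.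
- exact: hvH.
- exact: vvH.
- exact: hhV.
- exact: hvV.
- exact: vvV.
Qed.
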